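(* Let $\theta$ be an irrational number and let $$V_1=\{m_1\theta+m_2+a\cos m_3t+b\sin m_4t:\ m_1,m_2,m_3,m_4\in\mathbb{Z},\ a,b\in\mathbb{R},\ t\in[0,2\pi]\},$$ regarded as a set of real functions in $C(\mathbb{T})$ of the variable $\xi=e^{it}$, $t\in[0,2\pi]$. Let $d\neq 0$ be an integer, let $f_1,f_2:\mathbb{T}\to\mathbb{R}$ be continuous functions, and let $\alpha=\Phi_{\theta,d,f_1}$ and $\beta=\Phi_{\theta,d,f_2}$ be such that $f_1-f_2\in V_1$. Then $\alpha$ and $\beta$ are conjugate, i.e. there is a homeomorphism $\sigma:\mathbb{T}^2\to\mathbb{T}^2$ with $\sigma\circ\alpha\circ\sigma^{-1}=\beta$. Note that $V_1$ is dense in the real part of $C(\mathbb{T})$.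
   Context: $\mathbb{T}$ is the unit circle in $\mathbb{C}$. For an irrational number $\theta$, an integer $d\neq 0$ and a continuous function $f:\mathbb{T}\to\mathbb{R}$, the Furstenberg transform $\Phi_{\theta,d,f}:\mathbb{T}^2\to\mathbb{T}^2$ is the homeomorphism $\Phi_{\theta,d,f}(\xi,\zeta)=(\xi e^{2\pi i\theta},\ \zeta\,\xi^{d}e^{2\pi i f(\xi)})$. The real part of $C(\mathbb{T})$ is the space of real-valued continuous functions on $\mathbb{T}$ with the supremum norm.
   Formalization: V_1 is taken with finite sums of terms a cos m_3t + b sin m_4t, since single terms are not dense (cos t + cos 2t is not a limit), and with every m_3 nonzero, since m_3 = 0 would admit all real constants, for which conjugacy fails for some continuous f_1, f_2. *)

(* Defs.v *)
From HB Require Import structures.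
From mathcomp Require Import all_boot all_order all_algebra.
From mathcomp Require Import complex.
From mathcomp Require Import all_classical all_reals all_analysis.

Set Implicit Arguments.
Unset Strict Implicit.
Unset Printing Implicit Defensive.

Import Order.TTheory GRing.Theory Num.Theory.
Import numFieldNormedType.Exports.

Local Open Scope classical_set_scope.
Local Open Scope ring_scope.

(* [R[i]] carries no topology of its own; seen as a [numFieldType] it gets the
   topology of its norm, the modulus. *)
Definition cplx (R : realType) : numFieldType := R[i].

Definition unit_circle (R : realType) : set (cplx R) := [set z | `|z| = 1].

(* With the topology induced from [cplx R]. *)
Notation circle R := (set_type (@unit_circle R)).

Notation torus2 R := (circle R * circle R)%type.

Section Circle.
Context {R : realType}.
Implicit Types (x y z : circle R) (d : int) (t : R).

Lemma circle_norm z : `|val z| = 1.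
Proof. by case: z => z /= /set_mem. Qed.

Lemma unit_circleM x y : unit_circle (val x * val y).
Proof. by rewrite /unit_circle /= normrM !circle_norm mulr1. Qed.

Lemma unit_circleX z d : unit_circle (val z ^ d).
Proof.
rewrite /unit_circle /=; case: d => n.
  by rewrite -exprnP normrX circle_norm expr1n.
by rewrite NegzE -exprnN normfV normrX circle_norm expr1n invr1.
Qed.

Lemma unit_circle_cis t : @unit_circle R (cos t +i* sin t)%C.
Proof. by rewrite /unit_circle /= normc_def /= cos2Dsin2 sqrtr1. Qed.

Definition cmul x y : circle R := SigSub (mem_set (unit_circleM x y)).

Definition cexp z d : circle R := SigSub (mem_set (unit_circleX z d)).

(* [cis t] is e^{it}, [e2pii t] is e^{2 pi i t}. *)
Definition cis t : circle R := SigSub (mem_set (unit_circle_cis t)).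

Definition e2pii t : circle R := cis (2 * pi * t).

Definition furstenberg (theta : R) d (f : circle R -> R) :
    torus2 R -> torus2 R :=
  fun p => (cmul p.1 (e2pii theta),
            cmul (cmul p.2 (cexp p.1 d)) (e2pii (f p.1))).

(* The frequencies [m3 j] of the cosines are nonzero: [a * cos (0 * t)] would
   contribute every real constant, whereas the constants of the family are
   those of Z theta + Z.  The trigonometric part is a finite sum: single terms
   [a * cos (m3 * t) + b * sin (m4 * t)] (the case [n = 1]) do not give a dense
   family. *)
Definition V1 (theta : R) : set (circle R -> R) :=
  [set g | exists (m1 m2 : int) (n : nat)
             (m3 m4 : 'I_n -> int) (a b : 'I_n -> R),
     (forall j, m3 j != 0) /\
     forall t, 0 <= t <= 2 * pi ->
       g (cis t) = m1%:~R * theta + m2%:~R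
         + \sum_(j < n) (a j * cos ((m3 j)%:~R * t)
                         + b j * sin ((m4 j)%:~R * t))].

Import ArrowAsUniformType.

(* [continuousType (circle R) R] is the real part of C(T); the topology used
   here is that of uniform convergence, i.e., of the supremum norm. *)
Definition dense_in_real_continuous (V : set (circle R -> R)) : Prop :=
  V `<=` [set g | continuous g] /\
  dense [set g : continuousType (circle R) R | V g].

End Circle.

Definition conjugate (X : topologicalType) (alpha beta : X -> X) : Prop :=
  exists sigma sigma' : X -> X,
    [/\ cancel sigma sigma', cancel sigma' sigma,
        continuous sigma, continuous sigma' &
        sigma \o alpha \o sigma' = beta].

(* Main.v *)
Require Import Defs.
From HB Require Import structures.
From mathcomp Require Import all_boot all_order all_algebra.
From mathcomp Require Import complex.
From mathcomp Require Import all_classical all_reals all_analysis.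
From mathcomp Require Import ring lra zify.

Set Implicit Arguments.
Unset Strict Implicit.
Unset Printing Implicit Defensive.

Import Order.TTheory GRing.Theory Num.Theory.
Import numFieldNormedType.Exports.

Local Open Scope classical_set_scope.
Local Open Scope ring_scope.

(** Conjugacy.  Look for a conjugation that turns each fibre over the first
    coordinate, [sigma (z, y) = (z, y z^k e(h z))] with [h] continuous and
    [e(x) = exp(2 pi i x)].  It conjugates the two transforms as soon as
    [f1 - f2] equals [h - h(. e(theta)) - k theta] up to an integer, so integers
    are absorbed by the exponential, multiples of [theta] by the exponent [k],
    and there remains to see that a trigonometric polynomial without constant
    term is a coboundary [h - h(. e(theta))].  On a character [z^m] the
    coboundary operator is multiplication by [1 - e(m theta)], which vanishes
    only for [m = 0] because [theta] is irrational; so each real part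
    [Re (c z^m)] with [m <> 0] is a coboundary
    ([coboundary_character_part], [furstenberg_conjugate]).

    Density.  Real trigonometric polynomials are uniformly dense, and the
    constant term of such a polynomial can be moved into [Z theta + Z], which is
    dense in the line ([int_combination_dense]).  For the first point, average
    [f] over the [n]-th roots of unity [w_j] against the Fejer kernel
    [K(u) = |1 + u + ... + u^(n-1)|^2]:
    [L_n f (z) = n^-2 sum_j f(w_j) K(z / w_j)].  The weights are nonnegative and
    sum to one, because the [m]-th power sum of the [n]-th roots of unity vanishes
    for [0 < |m| < n] ([sum_fejer]), and [|z - w|^2 K(z / w) = |(z/w)^n - 1|^2 <= 4]
    ([sqmod_fejer]).  By compactness
    [|f z - f w| <= e + M |z - w|^2] for some [M] ([modulus_sqmod]), hence
    [|L_n f - f| <= e + 4 M / n], while [L_n f] is a trigonometric polynomial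
    because the kernel is one. *)

(** * Topology and exponentials on the circle *)

Section CircleTopology.
Variable R : realType.
Implicit Types (z : circle R) (t : R) (d : int).

Lemma Re_continuous : continuous (fun z : cplx R => complex.Re z).
Proof.
move=> z; apply/(@cvgrPdist_le _ _ _ _ (nbhs_filter z)) => e e0.
have e0C : (0 : cplx R) < (e%:C)%C by rewrite ltcR.
have := nbhsx_ballx z _ e0C; apply: filterS => w zw.
rewrite -lecR -raddfB; apply: le_trans (normc_ge_Re _) _; exact: ltW.
Qed.

Lemma real_complex_continuous : continuous (fun x : R => (x%:C)%C : cplx R).
Proof.
move=> x; apply/(@cvgrPdist_le _ _ _ _ (nbhs_filter x)) => e e0.
have eE : e = ((complex.Re e)%:C)%C by rewrite RRe_real// ger0_real// ltW.
have e'0 : 0 < complex.Re e by rewrite -ltcR -eE.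
have := nbhsx_ballx x _ e'0; apply: filterS => y xy.
rewrite -rmorphB /= normc_def /= expr0n addr0 sqrtr_sqr eE lecR; exact: ltW.
Qed.

Lemma circle_val_continuous : continuous (fun z : circle R => val z).
Proof. exact: initial_continuous. Qed.

(** The circle carries the initial topology of its inclusion in the plane. *)
Lemma circle_continuous (X : topologicalType) (f : X -> circle R) :
  continuous (fun x => val (f x)) -> continuous f.
Proof. by move=> cf; apply: continuous_comp_initial. Qed.

Lemma cis_continuous : continuous (@cis R).
Proof.
apply: circle_continuous => t.
rewrite (_ : (fun x => _) =
  (fun x => ((cos x)%:C)%C + 'i%C * ((sin x)%:C)%C)); last first.
  by apply/funext => x; exact: (complexE (cos x +i* sin x)%C).
apply: cvgD.
  by apply: continuous_comp; [exact: continuous_cos|exact: real_complex_continuous].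
apply: cvgMl_tmp.
by apply: continuous_comp; [exact: continuous_sin|exact: real_complex_continuous].
Qed.

Lemma cmul_continuous (X : topologicalType) (f g : X -> circle R) :
  continuous f -> continuous g -> continuous (fun x => cmul (f x) (g x)).
Proof.
move=> cf cg; apply: circle_continuous => x /=; apply: cvgM.
  by apply: continuous_comp; [exact: cf|exact: circle_val_continuous].
by apply: continuous_comp; [exact: cg|exact: circle_val_continuous].
Qed.

Lemma circle_neq0 z : val z != 0.
Proof. by rewrite -normr_eq0 circle_norm oner_neq0. Qed.

Lemma cexp_continuous (X : topologicalType) (f : X -> circle R) d :
  continuous f -> continuous (fun x => cexp (f x) d).
Proof.
move=> cf.
have natX n : continuous (fun x => val (f x) ^+ n).
  elim: n => [|n IH] x; first exact: cst_continuous.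
  have -> : (fun x => val (f x) ^+ n.+1) = (fun x => val (f x) * val (f x) ^+ n).
    by apply/funext => y; exact: exprS.
  apply: cvgM; last exact: IH.
  by apply: continuous_comp; [exact: cf|exact: circle_val_continuous].
apply: circle_continuous => x /=; case: d => n; first exact: natX.
by apply: cvgV; [rewrite expf_neq0// circle_neq0|exact: natX].
Qed.

Lemma cisD s t : cis (s + t) = cmul (cis s) (cis t).
Proof.
by apply: val_inj; rewrite /= cosD sinD; congr (Complex _ _); rewrite addrC.
Qed.

Lemma cis0 : val (cis (0 : R)) = 1.
Proof. by rewrite /= cos0 sin0. Qed.

Lemma cisMn t n : val (cis (t *+ n)) = val (cis t) ^+ n.
Proof.
elim: n => [|n IH]; first by rewrite mulr0n cis0.
by rewrite mulrSr cisD exprSr -IH.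
Qed.

Lemma cisN t : val (cis (- t)) = (val (cis t))^-1.
Proof.
apply: (mulIf (circle_neq0 (cis t))); rewrite mulVf ?circle_neq0//.
by rewrite -[LHS]/(val (cmul (cis (- t)) (cis t))) -cisD addNr cis0.
Qed.

(** De Moivre's formula, for integer exponents. *)
Lemma cisM t d : val (cis (d%:~R * t)) = val (cis t) ^ d.
Proof.
rewrite mulrzl; case: d => n; first exact: cisMn.
by rewrite NegzE mulrNz cisN cisMn exprnN.
Qed.

(** The angle is the arc cosine of the real part, or its reflection below the
    real axis. *)
Lemma cis_surj z : exists2 t, 0 <= t <= 2 * pi & z = cis t.
Proof.
case: z => -[a b] zP.
have ab1 : a ^+ 2 + b ^+ 2 = 1.
  apply: (@complexI R); rewrite (add_Re2_Im2 (a +i* b)%C).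
  by move/set_mem: (zP); rewrite /unit_circle /= => ->; rewrite expr1n.
have a1 : -1 <= a <= 1.
  by rewrite -ler_norml -[leRHS]sqrtr1 -sqrtr_sqr ler_wsqrtr// -ab1 lerDl sqr_ge0.
have sa : sin (acos a) = `|b|.
  by rewrite sin_acos// -ab1 (addrC (a ^+ 2)) addrK sqrtr_sqr.
have ca : cos (acos a) = a by rewrite acosK.
have := acos_ge0 a1; have := acos_lepi a1; have := pi_gt0 R => p0 ap a0.
have [b0|b0] := leP 0 b.
  exists (acos a); first by lra.
  by apply: val_inj; rewrite /= ca sa ger0_norm.
exists (2 * pi - acos a); first by lra.
apply: val_inj; rewrite /= mulrC mulr_natr addrC.
by rewrite cosD2pi sinD2pi cosN sinN ca sa ltr0_norm// opprK.
Qed.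

Lemma e2pii_int d : val (e2pii (d%:~R : R)) = 1.
Proof.
rewrite /e2pii mulrC cisM.
by rewrite mulrC mulr_natr /= cos2pi sin2pi exp1rz.
Qed.

(** Only integers reach the identity: after removing the floor, a real [y] with
    [0 <= y < 1] satisfies [cos (2 pi y) = 1], so [sin (pi y) = 0], and the sine has no
    zero strictly between 0 and pi. *)
Lemma e2pii_eq1 t : val (e2pii t) = 1 -> exists d : int, t = d%:~R.
Proof.
move=> t1; exists (Num.floor t).
have /andP[f1 f2] := floor_itv t.
set y := t - (Num.floor t)%:~R.
have y0 : 0 <= y by rewrite subr_ge0.
have y1 : y < 1 by rewrite ltrBlDr addrC -intrD1.
have : val (e2pii y) = 1.
  have := e2pii_int (Num.floor t); move: t1.
  rewrite /e2pii /y mulrBr cisD => t1 f1'.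
  by rewrite -[LHS]/(val (cis _) * val (cis (- _))) t1 cisN f1' invr1 mulr1.
move=> /(congr1 (@complex.Re R)) /=.
rewrite (_ : 2 * pi * y = (pi * y) *+ 2); last by rewrite mulr2n; ring.
rewrite cos_mulr2n => cy.
have sy : sin (pi * y) = 0.
  by apply/eqP; rewrite -sqrf_eq0 sin2cos2; apply/eqP; lra.
move: y0; rewrite le_eqVlt => /orP[/eqP y0|y0].
  by apply/eqP; rewrite -subr_eq0 -/y -y0.
have : 0 < sin (pi * y).
  by apply: sin_gt0_pi; rewrite mulr_gt0 ?pi_gt0//= gtr_pMr ?pi_gt0.
by rewrite sy ltxx.
Qed.

End CircleTopology.

(** * Coboundaries of the rotation and conjugacy *)

Section Conjugacy.
Variable R : realType.
Implicit Types (z : circle R) (c : R[i]) (theta : R) (m : int).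

(** The real trigonometric monomials: by [character_part_cis],
    [a cos (m t) + b sin (m t)] is the case [c = a - i b]. *)
Definition character_part c m z : R := complex.Re (c * (val z : R[i]) ^ m).

Lemma character_part_continuous c m : continuous (character_part c m).
Proof.
have cX : continuous (fun z => cexp z m) by apply: cexp_continuous => z; exact: cvg_id.
have cM (X : topologicalType) (f : X -> cplx R) :
    continuous f -> continuous (fun x => (c : cplx R) * f x).
  by move=> cf x; apply: cvgMl_tmp; exact: cf.
have cv : continuous (fun z => val (cexp z m)).
  by move=> z; apply: continuous_comp; [exact: cX|exact: circle_val_continuous].
move=> z; exact: (continuous_comp (cM _ _ cv z) (@Re_continuous R _)).
Qed.

Lemma character_part_cis c m t :
  character_part c m (cis t) =
  complex.Re c * cos (m%:~R * t) - complex.Im c * sin (m%:~R * t).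
Proof. by rewrite /character_part -cisM; case: c. Qed.

Lemma irrational_mulz_neq_int theta m (k : int) :
  irrational theta -> m != 0 -> m%:~R * theta != k%:~R.
Proof.
move=> itheta m0; apply/eqP => mk; apply: itheta.
exists (k%:~R / m%:~R) => //; rewrite fmorph_div/= !ratr_int -mk.
by rewrite mulrC mulKf// intr_eq0.
Qed.

(** The functions [h - h o T], where [T] is the rotation by [theta] turns. *)
Definition coboundary theta (g : circle R -> R) :=
  exists2 h : circle R -> R, continuous h &
    forall z, g z = h z - h (cmul z (e2pii theta)).

Lemma coboundaryD theta g1 g2 : coboundary theta g1 -> coboundary theta g2 ->
  coboundary theta (fun z => g1 z + g2 z).
Proof.
move=> [h1 ch1 h1E] [h2 ch2 h2E]; exists (fun z => h1 z + h2 z).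
  by move=> z; exact: (continuousD (ch1 z) (ch2 z)).
by move=> z; rewrite h1E h2E opprD addrACA.
Qed.

Lemma coboundary_sum theta n (g : 'I_n -> circle R -> R) :
  (forall j, coboundary theta (g j)) ->
  coboundary theta (fun z => \sum_(j < n) g j z).
Proof.
move=> cg; rewrite -(fct_sumE _ _ g).
elim/big_ind: _ => [|g1 g2|j _]; [|exact: coboundaryD|exact: cg].
by exists (fun=> 0); [exact: cst_continuous|move=> z; rewrite subr0].
Qed.

(** Since [h - h o T] multiplies [z^m] by [1 - e(m theta)], the equation is solved
    by dividing the coefficient by this number, nonzero by irrationality. *)
Lemma coboundary_character_part theta c m : irrational theta -> m != 0 ->
  coboundary theta (character_part c m).
Proof.
move=> itheta m0; pose u : R[i] := 1 - val (e2pii (m%:~R * theta)).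
have u0 : u != 0.
  rewrite subr_eq0; apply/eqP => /esym/e2pii_eq1[k mk].
  by have := irrational_mulz_neq_int k itheta m0; rewrite mk eqxx.
exists (character_part (c / u) m); first exact: character_part_continuous.
move=> z; rewrite /character_part -raddfB /= -mulrBr; congr complex.Re.
have -> : (val z * val (e2pii theta)) ^ m =
          (val z) ^ m * val (e2pii (m%:~R * theta)).
  by rewrite expfzMl /e2pii mulrCA cisM.
by rewrite -[X in X - _ * _]mulr1 -mulrBr -/u mulrCA divfK// mulrC.
Qed.

(** The defining formula of the family holds on angles of [0, 2 pi]; these cover
    the circle, which gives a formula in [z]. *)
Lemma V1_character_parts theta g : V1 theta g ->
  exists (m1 m2 : int) (n : nat) (m3 m4 : 'I_n -> int) (a b : 'I_n -> R),
    (forall j, m3 j != 0) /\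
    g = (fun z => m1%:~R * theta + m2%:~R +
      \sum_(j < n) (character_part ((a j)%:C)%C (m3 j) z
                    + character_part (0 -i* b j)%C (m4 j) z)).
Proof.
move=> [m1 [m2 [n [m3 [m4 [a [b [m30 gE]]]]]]]].
exists m1, m2, n, m3, m4, a, b; split=> //; apply/funext => z.
have [t t02 ->] := cis_surj z; rewrite gE//; congr (_ + _).
apply: eq_bigr => j _; rewrite !character_part_cis /=.
by rewrite !mul0r subr0 sub0r mulNr opprK.
Qed.

Lemma e2piiD (s t : R) : val (e2pii (s + t)) = val (e2pii s) * val (e2pii t).
Proof. by rewrite /e2pii mulrDr cisD. Qed.

Lemma e2piiN (s : R) : val (e2pii (- s)) = (val (e2pii s))^-1.
Proof. by rewrite /e2pii mulrN cisN. Qed.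

Lemma e2pii_continuous : continuous (@e2pii R).
Proof.
move=> x; apply: (@continuous_comp _ _ _ (fun x => 2 * pi * x) (@cis R)).
  by apply: cvgMl_tmp; exact: cvg_id.
exact: cis_continuous.
Qed.

Lemma pair_continuous (X Y Z : topologicalType) (f : X -> Y) (g : X -> Z) :
  continuous f -> continuous g -> continuous (fun x => (f x, g x)).
Proof. by move=> cf cg x; apply: cvg_pair; [exact: cf|exact: cg]. Qed.

Definition fiber_rotation (k : int) (h : circle R -> R) (p : torus2 R) : torus2 R :=
  (p.1, cmul (cmul p.2 (cexp p.1 k)) (e2pii (h p.1))).

Lemma fiber_rotation_continuous k h : continuous h ->
  continuous (fiber_rotation k h).
Proof.
move=> ch.
have c1 : continuous (fun p : torus2 R => cmul p.2 (cexp p.1 k)).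
  apply: cmul_continuous; first by move=> p; exact: cvg_snd.
  by apply: cexp_continuous => p; exact: cvg_fst.
have c2 : continuous (fun p : torus2 R => e2pii (h p.1)).
  move=> p; apply: (@continuous_comp _ _ _ (h \o fst) (@e2pii R)).
    by apply: continuous_comp; [exact: cvg_fst|exact: ch].
  exact: e2pii_continuous.
by apply: pair_continuous; [move=> p; exact: cvg_fst|exact: cmul_continuous].
Qed.

Lemma fiber_rotationK k h :
  cancel (fiber_rotation k h) (fiber_rotation (- k) (\- h)).
Proof.
move=> [z y]; congr pair; apply: val_inj.
change (val y * val z ^ k * val (e2pii (h z)) * val z ^ (- k) *
  val (e2pii (- h z)) = val y).
rewrite e2piiN -invr_expz.
by rewrite mulrAC mulfK ?circle_neq0// mulfK// (circle_neq0 (cexp z k)).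
Qed.

(** Conjugating by [fiber_rotation k h] multiplies the second coordinate by
    [e(h (z e(theta)) - h z + k theta)], which turns [f1] into [f2] up to the
    integer [m], and [e(m) = 1]. *)
Lemma furstenberg_conjugate theta d (f1 f2 h : circle R -> R) (k m : int) :
  continuous h ->
  (forall z, f1 z - f2 z =
     h z - h (cmul z (e2pii theta)) - k%:~R * theta + m%:~R) ->
  conjugate (furstenberg theta d f1) (furstenberg theta d f2).
Proof.
move=> ch fE; exists (fiber_rotation k h), (fiber_rotation (- k) (\- h)); split.
- exact: fiber_rotationK.
- have := fiber_rotationK (- k) (\- h); rewrite opprK.
  by congr (cancel _ (fiber_rotation _ _)); apply/funext => z /=; rewrite opprK.
- exact: fiber_rotation_continuous.
- by apply: fiber_rotation_continuous => z; exact: (continuousN (ch z)).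
apply/funext => -[z y]; rewrite /furstenberg /fiber_rotation /=.
congr pair; apply: val_inj.
set z' := cmul z _ in fE *.
change (val y * val z ^ (- k) * val (e2pii (- h z)) * val z ^ d * val (e2pii (f1 z))
  * (val z * val (e2pii theta)) ^ k * val (e2pii (h z'))
  = val y * val z ^ d * val (e2pii (f2 z))).
have -> : f1 z = f2 z + (h z + - h z' + - (k%:~R * theta) + m%:~R).
  by rewrite -fE addrC subrK.
rewrite !(e2piiD, e2piiN) e2pii_int mulr1.
have -> : (val z * val (e2pii theta)) ^ k = val z ^ k * val (e2pii (k%:~R * theta)).
  by rewrite expfzMl /e2pii mulrCA cisM.
rewrite -invr_expz.
have := circle_neq0 (cexp z k); have := circle_neq0 (e2pii (h z)).
have := circle_neq0 (e2pii (h z')); have := circle_neq0 (e2pii (k%:~R * theta)).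
rewrite -[val (cexp z k)]/(val z ^ k).
move: (val (e2pii (h z))) (val (e2pii (h z'))) (val (e2pii (k%:~R * theta))).
move: (val z ^ k) (val z ^ d) (val y) (val (e2pii (f2 z))).
move=> e f y' g u v w u0 v0 w0 e0; field.
by rewrite ?u0 ?v0 ?w0 ?e0.
Qed.

(** The terms of nonzero frequency are coboundaries; a sine of frequency zero
    vanishes, and zero is the coboundary of zero. *)
Lemma V1_conjugate (theta : R) d f1 f2 : irrational theta -> V1 theta (f1 \- f2) ->
  conjugate (furstenberg theta d f1) (furstenberg theta d f2).
Proof.
move=> itheta /V1_character_parts[m1 [m2 [n [m3 [m4 [a [b [m30 fE]]]]]]]].
have [h ch hE] : coboundary theta (fun z =>
    \sum_(j < n) (character_part ((a j)%:C)%C (m3 j) z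
                  + character_part (0 -i* b j)%C (m4 j) z)).
  apply: coboundary_sum => j; apply: coboundaryD.
    exact: coboundary_character_part.
  have [m40|m40] := eqVneq (m4 j) 0; last exact: coboundary_character_part.
  exists (fun=> 0); first exact: cst_continuous.
  by move=> z; rewrite /character_part m40 expr0z mulr1 subr0.
apply: (furstenberg_conjugate _ (k := - m1) (m := m2) ch) => z.
rewrite -hE -[LHS]/((f1 \- f2) z) fE mulrNz; ring.
Qed.

End Conjugacy.

(** * Density of the group generated by 1 and an irrational *)

Section DenseSubgroup.
Variable R : realType.
Implicit Types (theta e : R).

(** Start from the fractional part of [theta] and run Euclid's algorithm on [1]
    and [g = m1 theta + m2], in the halving form: if
    [k g <= 1 < (k + 1) g], the combinations [1 - k g] and [(k + 1) g - 1] are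
    nonnegative with sum [g], so one of them is at most [g / 2].  The condition
    [m1 <> 0] makes the combinations irrational, hence nonzero, and is
    inherited. *)
Lemma small_int_combination theta n : irrational theta ->
  exists m1 m2 : int, m1 != 0 /\ 0 < m1%:~R * theta + m2%:~R <= 2 ^- n.
Proof.
move=> itheta; elim: n => [|n [m1 [m2 [m10 /andP[g0 gn]]]]].
  exists 1, (- Num.floor theta); split=> //.
  have /andP[f1 f2] := floor_itv theta.
  have := irrational_mulz_neq_int (Num.floor theta) itheta (oner_neq0 _).
  rewrite mulr1z mul1r expr0 invr1 mulrNz => tf.
  rewrite subr_gt0 lt_neqAle eq_sym tf f1/=.
  by move: f2; rewrite intrD1; lra.
set g := _ + _ in g0 gn.
have g1 : g <= 1 by rewrite (le_trans gn)// invf_le1 ?exprn_gt0// exprn_ege1 ?ler1n.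
pose k := Num.floor g^-1.
have k1 : 1 <= k by rewrite floor_ge_int mulr1z invf_ge1.
have /andP[kg gk] := floor_itv g^-1; rewrite -/k in kg gk.
have kg1 : k%:~R * g <= 1 by rewrite -ler_pdivlMr// div1r.
have gk1 : 1 < (k + 1)%:~R * g by rewrite -ltr_pdivrMr// div1r.
have km0 : (- k) * m1 != 0 by rewrite mulf_neq0// oppr_eq0; lia.
have rE : 1 - k%:~R * g = ((- k) * m1)%:~R * theta + (1 - k * m2)%:~R.
  by rewrite /g !(intrD, intrM, mulrNz); ring.
have sE : (k + 1)%:~R * g - 1 = ((k + 1) * m1)%:~R * theta + ((k + 1) * m2 - 1)%:~R.
  by rewrite /g !(intrD, intrM, mulrNz); ring.
have r0 : 0 < 1 - k%:~R * g.
  rewrite lt_neqAle subr_ge0 kg1 andbT eq_sym rE addr_eq0 -mulrNz.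
  exact: irrational_mulz_neq_int.
have e2 : 2 ^- n.+1 = 2 ^- n / 2 :> R by rewrite exprSr invfM.
have rs : (1 - k%:~R * g) + ((k + 1)%:~R * g - 1) = g by rewrite intrD; ring.
have [rg|rg] := leP (1 - k%:~R * g) (g / 2).
  exists ((- k) * m1), (1 - k * m2); split; rewrite -?rE//.
  by rewrite r0 e2; lra.
exists ((k + 1) * m1), ((k + 1) * m2 - 1); split; last first.
  by rewrite -sE e2; apply/andP; split; lra.
by rewrite mulf_neq0//; lia.
Qed.

(** Integer multiples of a small positive element come close to every real. *)
Lemma int_combination_dense theta (c e : R) : irrational theta -> 0 < e ->
  exists m1 m2 : int, `|c - (m1%:~R * theta + m2%:~R)| < e.
Proof.
move=> itheta e0; have [n ne] : exists n, (2 : R) ^- n < e.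
  exists (Num.truncn e^-1).+1; rewrite invf_plt ?posrE ?exprn_gt0//.
  rewrite (lt_le_trans (truncnS_gt _))// -natrX ler_nat.
  by rewrite ltnW// ltn_expl.
have [m1 [m2 [_ /andP[g0 gn]]]] := small_int_combination n itheta.
set g := _ + _ in g0 gn; pose k := Num.floor (c / g).
have /andP[kg gk] := floor_itv (c / g); rewrite -/k in kg gk.
exists (k * m1), (k * m2).
have -> : (k * m1)%:~R * theta + (k * m2)%:~R = k%:~R * g :> R.
  by rewrite /g !intrM; ring.
have : k%:~R * g <= c by rewrite -ler_pdivlMr.
have : c < (k + 1)%:~R * g by rewrite -ltr_pdivrMr.
by rewrite intrD mulrDl mul1r => h1 h2; rewrite ger0_norm; lra.
Qed.

End DenseSubgroup.

(** * The Fejer kernel on roots of unity *)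

Section Fejer.
Variable R : realType.
Implicit Types (x y u v : R[i]) (z w : circle R) (n : nat) (m : int).

Definition sqmod x : R := complex.Re x ^+ 2 + complex.Im x ^+ 2.

Lemma sqmod_ge0 x : 0 <= sqmod x.
Proof. by rewrite addr_ge0 ?sqr_ge0. Qed.

Lemma sqmodE x : sqmod x = complex.Re (x * (x^*)%C).
Proof. by case: x => a b; rewrite /sqmod /=; ring. Qed.

Lemma sqmodM x y : sqmod (x * y) = sqmod x * sqmod y.
Proof. by case: x => a b; case: y => c d; rewrite /sqmod /=; ring. Qed.

Lemma sqmod_eq0 x : sqmod x = 0 -> x = 0.
Proof.
case: x => a b /eqP; rewrite /sqmod /= paddr_eq0 ?sqr_ge0// !sqrf_eq0.
by move=> /andP[/eqP -> /eqP ->].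
Qed.

Lemma sqmod_circle z : sqmod (val z) = 1.
Proof.
by apply: (@complexI R); rewrite add_Re2_Im2; move: (circle_norm z) => /= ->;
  rewrite expr1n.
Qed.

Lemma conjc_circle z : ((val z : R[i])^*)%C = (val z)^-1.
Proof.
apply: (mulfI (circle_neq0 z)); rewrite mulfV ?circle_neq0// -sqr_normc.
by move: (circle_norm z) => /= ->; rewrite expr1n.
Qed.

Lemma sqmod_circleB z w : sqmod ((val z : R[i]) - val w) <= 4.
Proof.
have := sqmod_circle z; have := sqmod_circle w; rewrite /sqmod.
case: (val z) => a b; case: (val w) => c d /=.
have := sqr_ge0 (a + c); have := sqr_ge0 (b + d).
by rewrite sqrrD !sqrrB; lra.
Qed.

(** Without normalization: [n * F_n] for the usual Fejer kernel [F_n]. *)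
Definition fejer n u : R := sqmod (\sum_(k < n) u ^+ k).

Lemma fejer_ge0 n u : 0 <= fejer n u.
Proof. exact: sqmod_ge0. Qed.

(** With [u = z / w], the product is [|(u - 1)(1 + u + ... + u^(n-1))|^2], which
    telescopes to [|u^n - 1|^2], a squared chord of the circle. *)
Lemma sqmod_fejer n z w :
  sqmod ((val z : R[i]) - val w) * fejer n ((val z : R[i]) / val w) <= 4.
Proof.
pose u : R[i] := val z / val w.
have -> : sqmod ((val z : R[i]) - val w) = sqmod (u - 1).
  rewrite -[RHS]mulr1 -(sqmod_circle w) -sqmodM mulrBl mul1r /u.
  by rewrite divfK ?circle_neq0.
rewrite -/u /fejer -sqmodM -subrX1.
pose v := cexp (cmul z (cexp w (- 1))) n.
have -> : u ^+ n = val v by [].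
by have := sqmod_circleB v (cis 0); rewrite cis0.
Qed.

Lemma fejerE n z : fejer n (val z) =
  \sum_(k < n) \sum_(l < n) complex.Re ((val z : R[i]) ^ (k%:Z - l%:Z)).
Proof.
rewrite /fejer sqmodE rmorph_sum/= mulr_suml raddf_sum; apply: eq_bigr => k _.
rewrite mulr_sumr raddf_sum; apply: eq_bigr => l _; congr complex.Re.
rewrite rmorphXn/= conjc_circle expfzDr ?circle_neq0// -exprnP.
by rewrite -invr_expz -exprnP exprVn.
Qed.

Definition root_of_unity n : circle R := e2pii n%:R^-1.

(** Orthogonality of the characters of Z/n, restricted to [|m| < n]; off [m = 0]
    it is a geometric sum whose ratio has [n]-th power one. *)
Lemma sum_root_of_unity n m : (0 < n)%N -> (`|m| < n)%N ->
  \sum_(j < n) (val (root_of_unity n) : R[i]) ^ (m * j) =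
  if m == 0 then n%:R else 0.
Proof.
move=> n0 mn; have nR : n%:R != 0 :> R by rewrite pnatr_eq0 -lt0n.
case: ifPn => [/eqP ->|m0].
  by under eq_bigr do rewrite mul0r expr0z; rewrite sumr_const card_ord.
pose v : R[i] := val (root_of_unity n) ^ m.
have vE : v = val (e2pii (m%:~R / n%:R : R)).
  by rewrite /v /root_of_unity /e2pii mulrCA cisM.
under eq_bigr do rewrite -exprz_exp -exprnP -/v.
have v1 : v - 1 != 0.
  rewrite subr_eq0 vE; apply/eqP => /e2pii_eq1[k mk].
  have {mk} : m = k * n.
    apply/eqP; rewrite -(eqr_int R) intrM -pmulrn; apply/eqP.
    by rewrite -mk divfK.
  move=> mk; have k0 : k != 0 by apply: contraNneq m0 => k0; rewrite mk k0 mul0r.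
  by move: mn; rewrite mk abszM absz_nat; have := absz_eq0 k; nia.
apply: (mulfI v1); rewrite mulr0 -subrX1 exprnP /v exprzAC.
suff -> : (val (root_of_unity n) : R[i]) ^ n = 1 by rewrite exp1rz subrr.
by rewrite /root_of_unity /e2pii -cisM mulrCA -pmulrn divff// -[RHS](e2pii_int R 1).
Qed.

Definition node n (j : nat) : circle R := cexp (root_of_unity n) j.

(** In the expansion [K(u) = sum_(k, l) u^(k - l)] the sum over the nodes kills
    every term with [k <> l], and each of the [n] diagonal terms gives [n]. *)
Lemma sum_fejer n z : (0 < n)%N ->
  \sum_(j < n) fejer n ((val z : R[i]) / val (node n j)) = n%:R ^+ 2.
Proof.
move=> n0.
have E (j : 'I_n) : fejer n ((val z : R[i]) / val (node n j)) =
   \sum_(k < n) \sum_(l < n) complex.Re ((val z : R[i]) ^ (k%:Z - l%:Z) *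
      (val (root_of_unity n) : R[i]) ^ ((l%:Z - k%:Z) * j)).
  rewrite -[LHS]/(fejer n (val (cmul z (cexp (node n j) (- 1))))) fejerE.
  apply: eq_bigr => k _; apply: eq_bigr => l _; congr complex.Re => /=.
  rewrite expfzMl !exprz_exp; congr (_ * _ ^ _); lia.
rewrite (eq_bigr _ (fun j _ => E j)) exchange_big /=.
rewrite (eq_bigr (fun=> n%:R)) => [|k _].
  by rewrite sumr_const card_ord expr2 mulr_natr.
rewrite exchange_big /= (bigD1 k)//= [X in _ + X]big1 ?addr0 => [|l lk].
  under eq_bigr do rewrite subrr mul0r !expr0z mulr1.
  by rewrite sumr_const card_ord.
rewrite -raddf_sum -mulr_sumr sum_root_of_unity//; last first.
  by move: (ltn_ord k) (ltn_ord l); lia.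
rewrite ifF ?mulr0//; apply: contra_neqF lk => /eqP lk; apply: val_inj => /=; lia.
Qed.

End Fejer.

(** * Compactness and the modulus of continuity *)

Section CompactTorus.
Variable R : realType.
Implicit Types (z w : circle R) (f : circle R -> R) (theta e : R) (n : nat).

Lemma circle_compact : compact [set: circle R].
Proof.
have -> : [set: circle R] = @cis R @` `[0, 2 * pi].
  apply/seteqP; split=> // z _; have [t t02 ->] := cis_surj z.
  by exists t => //=; rewrite in_itv.
apply: continuous_compact; last exact: segment_compact.
by apply: continuous_subspaceT; exact: cis_continuous.
Qed.

(** The squared distance is affine in the real part of [z / w], which makes it a
    continuous function on the torus. *)
Lemma sqmod_circleBE z w : sqmod ((val z : R[i]) - val w) =
  2 - 2 * character_part 1 1 (cmul z (cexp w (- 1))).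
Proof.
rewrite /character_part mul1r expr1z.
have -> : val (cmul z (cexp w (- 1))) = (val z : R[i]) * ((val w)^*)%C.
  by rewrite conjc_circle.
have := sqmod_circle z; have := sqmod_circle w; rewrite /sqmod.
case: (val z) => a b; case: (val w) => c d /=.
by rewrite !sqrrB; lra.
Qed.

(** A quantitative substitute for uniform continuity: the square distance is the
    quantity that the Fejer kernel controls.  At a point [(z, w)] some [M] gives a
    strict inequality, by division if [z <> w] and trivially on the diagonal; it
    persists nearby and for larger [M], and compactness of the torus makes [M]
    uniform. *)
Lemma modulus_sqmod f e : continuous f -> 0 < e ->
  exists2 M : R, 0 <= M & forall z w,
    `|f z - f w| <= e + M * sqmod ((val z : R[i]) - val w).
Proof.
move=> cf e0.
pose P M (p : torus2 R) :=
  `|f p.1 - f p.2| <= e + M * sqmod ((val p.1 : R[i]) - val p.2).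
have sub_cont (X : topologicalType) (M : R) (a b c : X -> R) :
    continuous a -> continuous b -> continuous c ->
    continuous (fun x => e + M * (2 - 2 * c x) - `|a x - b x|).
  move=> ca cb cc x; apply: cvgB.
    apply: cvgD; first exact: cvg_cst.
    apply: cvgMl_tmp; apply: cvgB; first exact: cvg_cst.
    by apply: cvgMl_tmp; exact: cc.
  by apply: cvg_norm; apply: cvgB; [exact: ca|exact: cb].
have c1 : continuous (fun p : torus2 R => p.1) by move=> p; exact: cvg_fst.
have c2 : continuous (fun p : torus2 R => p.2) by move=> p; exact: cvg_snd.
have cq : continuous (fun p : torus2 R =>
    character_part 1 1 (cmul p.1 (cexp p.2 (- 1)))).
  have cm := cmul_continuous c1 (@cexp_continuous _ _ _ (- 1) c2).
  by move=> p; exact: (continuous_comp (cm p) (@character_part_continuous R 1 1 _)).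
have cf1 : continuous (fun p : torus2 R => f p.1).
  by move=> p; exact: (continuous_comp (c1 p) (cf _)).
have cf2 : continuous (fun p : torus2 R => f p.2).
  by move=> p; exact: (continuous_comp (c2 p) (cf _)).
have cpt : compact [set: torus2 R].
  by rewrite -setXTT; apply: compact_setX; exact: circle_compact.
(* [M] tends to infinity along the filter of the covering. *)
have : near_covering [set: torus2 R] by apply/compact_near_coveringP.
move=> /(_ R (pinfty_nbhs R) P _)[] => [[z w] _|].
  set q := sqmod ((val z : R[i]) - val w).
  have [M M0] : exists2 M, 0 <= M & 0 < e + M * q - `|f z - f w|.
    have [zw|zw] := eqVneq z w.
      by exists 0 => //; rewrite zw subrr normr0 mul0r; lra.
    have q0 : 0 < q.
      rewrite lt_neqAle sqmod_ge0 andbT eq_sym; apply: contra_neq zw => /sqmod_eq0.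
      by move=> /eqP; rewrite subr_eq0 => /eqP/val_inj.
    exists (`|f z - f w| / q); first by rewrite divr_ge0// ltW.
    by rewrite divfK ?gt_eqF//; lra.
  rewrite /q sqmod_circleBE => gM.
  have := sub_cont _ M _ _ _ cf1 cf2 cq (z, w).
  move=> /(_ _ (lt_nbhsr gM)) /= near_zw.
  exists ([set p : torus2 R | 0 < e + M * (2 - 2 * character_part 1 1
    (cmul p.1 (cexp p.2 (- 1)))) - `|f p.1 - f p.2| ], [set N | M <= N]) => /=.
    by split; [exact: near_zw|apply: nbhs_pinfty_ge; exact: num_real].
  move=> [p N] /= [+ MN]; rewrite -sqmod_circleBE subr_gt0 /P => /ltW/le_trans.
  by apply; rewrite lerD2l ler_wpM2r// sqmod_ge0.
move=> M0 [_ MP]; exists (Num.max M0 0 + 1) => [|z w].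
  by rewrite addr_ge0// le_max lexx orbT.
apply: (MP _ _ (z, w)) => //.
by have : M0 <= Num.max M0 0 by [rewrite le_max lexx]; lra.
Qed.

End CompactTorus.

(** * Uniform approximation by trigonometric polynomials *)

Section FejerMeans.
Variable R : realType.
Implicit Types (z w : circle R) (f : circle R -> R) (theta e : R) (n : nat).

Definition fejer_mean n f z : R :=
  n%:R ^- 2 * \sum_(j < n) f (node R n j) *
    fejer n ((val z : R[i]) / val (node R n j)).

(** The mean is a convex combination of the values [f w_j], so the error is at
    most the mean of [e / 2 + M |z - w_j|^2]; the second part is at most
    [4 M / n]. *)
Lemma fejer_mean_cvg f e : continuous f -> 0 < e ->
  exists2 n, (0 < n)%N & forall z, `|fejer_mean n f z - f z| < e.
Proof.
move=> cf e0; have [M M0 fM] := modulus_sqmod cf (divr_gt0 e0 (ltr0n _ 2)).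
(* This size of [n] makes [4 M / n < e / 2]. *)
pose n := (Num.truncn (8 * M / e)).+1; exists n => // z.
have n0 : 0 < n%:R :> R by rewrite ltr0n.
have nM : 8 * M < n%:R * e by rewrite -ltr_pdivrMr// truncnS_gt.
have fz : f z =
    n%:R ^- 2 * \sum_(j < n) f z * fejer n ((val z : R[i]) / val (node R n j)).
  by rewrite -mulr_sumr sum_fejer// mulrCA mulVf ?mulr1// expf_neq0// gt_eqF.
rewrite [X in _ - X]fz /fejer_mean -mulrBr -sumrB normrM gtr0_norm ?invr_gt0 ?exprn_gt0//.
rewrite mulrC ltr_pdivrMr ?exprn_gt0//.
have : `|\sum_(j < n) (f (node R n j) * fejer n ((val z : R[i]) / val (node R n j)) -
           f z * fejer n ((val z : R[i]) / val (node R n j)))| <=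
   \sum_(j < n) (e / 2 * fejer n ((val z : R[i]) / val (node R n j)) + M * 4).
  apply: le_trans (ler_norm_sum _ _ _) _; apply: ler_sum => j _.
  rewrite -mulrBl normrM (ger0_norm (fejer_ge0 _ _)) distrC.
  apply: le_trans (ler_wpM2r (fejer_ge0 _ _) (fM _ _)) _.
  by rewrite mulrDl lerD2l -mulrA ler_wpM2l// sqmod_fejer.
move/le_lt_trans; apply.
rewrite big_split/= -mulr_sumr sum_fejer// sumr_const card_ord -mulr_natl.
by rewrite expr2; nra.
Qed.

(** The terms [k = l] of the kernel have exponent zero and form the constant
    [C]; in the others the exponent [k - l] is nonzero, as the family of the
    theorem requires. *)
Lemma fejer_mean_characters n f :
  exists (C : R) (c : 'I_n * ('I_n * 'I_n) -> R[i]),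
    forall z, fejer_mean n f z = C +
      \sum_(x | x.2.1 != x.2.2) character_part (c x) (x.2.1%:Z - x.2.2%:Z) z.
Proof.
pose c (x : 'I_n * ('I_n * 'I_n)) : R[i] :=
  ((n%:R ^- 2 * f (node R n x.1))%:C)%C *
  ((val (node R n x.1))^-1) ^ (x.2.1%:Z - x.2.2%:Z).
exists (\sum_(x | ~~ (x.2.1 != x.2.2)) complex.Re (c x)), c => z.
rewrite /fejer_mean mulr_sumr.
transitivity (\sum_x character_part (c x) (x.2.1%:Z - x.2.2%:Z) z).
  rewrite -(pair_bigA _ (fun j y => character_part (c (j, y)) (y.1%:Z - y.2%:Z) z)) /=.
  apply: eq_bigr => j _.
  rewrite -(pair_bigA _ (fun k l => character_part (c (j, (k, l))) (k%:Z - l%:Z) z)) /=.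
  rewrite -[(val z : R[i]) / _]/(val (cmul z (cexp (node R n j) (- 1)))) fejerE.
  rewrite mulrA !mulr_sumr; apply: eq_bigr => k _.
  rewrite mulr_sumr; apply: eq_bigr => l _.
  rewrite /character_part /c /= -[X in _ = complex.Re X]mulrA -expfzMl.
  set u : R[i] := (X in _ = complex.Re (_ * X)).
  have -> : u = ((val z : R[i]) / val (node R n j)) ^ (k%:Z - l%:Z) by rewrite /u mulrC.
  by case: (_ ^ _) => p q /=; rewrite mul0r subr0.
have splitE (F G : 'I_n * ('I_n * 'I_n) -> R) :
    (forall x, x.2.1 = x.2.2 -> F x = G x) ->
    \sum_x F x =
    \sum_(x | ~~ (x.2.1 != x.2.2)) G x + \sum_(x | x.2.1 != x.2.2) F x.
  move=> FG; rewrite (bigID (fun x => x.2.1 != x.2.2)) addrC.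
  by congr (_ + _); apply: eq_bigr => x; rewrite negbK => /eqP; exact: FG.
apply: splitE => x xx.
by rewrite /character_part xx subrr expr0z mulr1.
Qed.

(** A frequency carries both a cosine and a sine, so [m3 = m4]; the index type is
    enumerated to get ordinals. *)
Lemma V1_of_characters theta (m1 m2 : int) (T : finType) (P : pred T)
    (m : T -> int) (c : T -> R[i]) : (forall x, P x -> m x != 0) ->
  V1 theta (fun z => m1%:~R * theta + m2%:~R +
    \sum_(x | P x) character_part (c x) (m x) z).
Proof.
move=> m0; exists m1, m2, #|P|, (m \o enum_val), (m \o enum_val).
exists (fun j => complex.Re (c (enum_val j))), (fun j => - complex.Im (c (enum_val j))).
split=> [j|t _]; first exact: (m0 _ (enum_valP j)).
congr (_ + _); rewrite (eq_bigl (fun x => x \in P))// big_enum_val; apply: eq_bigr => j _.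
by rewrite character_part_cis mulNr.
Qed.

Lemma V1_continuous theta g : V1 theta g -> continuous g.
Proof.
move=> /V1_character_parts[m1 [m2 [n [m3 [m4 [a [b [_ ->]]]]]]]].
have cD (g1 g2 : circle R -> R) : continuous g1 -> continuous g2 ->
    continuous (fun z => g1 z + g2 z).
  by move=> c1 c2 z; exact: (continuousD (c1 z) (c2 z)).
apply: (cD); first exact: cst_continuous.
rewrite -(fct_sumE _ _ (fun j z => character_part _ (m3 j) z + _)).
elim/big_ind: _ => [|g1 g2|j _]; [exact: cst_continuous|exact: (cD)|].
by apply: cD; exact: character_part_continuous.
Qed.

(** The constant term of a Fejer mean is moved to a nearby element of
    [Z theta + Z], at the price of half of the error. *)
Lemma V1_approximation theta f e : irrational theta -> continuous f -> 0 < e ->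
  exists2 g, V1 theta g & forall z, `|f z - g z| < e.
Proof.
move=> itheta cf e0; have e20 : 0 < e / 2 by rewrite divr_gt0.
have [n n0 fn] := fejer_mean_cvg cf e20.
have [C [c fE]] := fejer_mean_characters n f.
have [m1 [m2 Cm]] := int_combination_dense C itheta e20.
eexists.
  apply: (@V1_of_characters theta m1 m2 _ (fun x : 'I_n * ('I_n * 'I_n) => x.2.1 != x.2.2)
    (fun x => x.2.1%:Z - x.2.2%:Z) c) => -[j [k l]] /=.
  by apply: contra_neq => kl; apply: val_inj => /=; lia.
move=> z; have := fn z; rewrite fE; move: Cm; set s := \sum_(x | _) _ => Cm Cs.
rewrite (_ : _ - _ = (C - (m1%:~R * theta + m2%:~R)) - (C + s - f z)); last by ring.
by rewrite (le_lt_trans (ler_normB _ _))// [e]splitr ltrD.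
Qed.

End FejerMeans.

Section UniformDensity.
Variable R : realType.
Import ArrowAsUniformType.

(** An open set of continuous functions contains a uniform ball around each of
    its points. *)
Lemma V1_dense (theta : R) : irrational theta -> dense_in_real_continuous (V1 theta).
Proof.
move=> itheta; split=> [g|O [f Of] oO]; first exact: V1_continuous.
case: oO => A oA AO; have Af : A f by move: Of; rewrite -AO.
move: oA; rewrite openE => /(_ _ Af); rewrite /interior -nbhs_entourageE.
move=> [E [P + PE] EA]; rewrite -entourage_ballE => -[e /= e0 eP].
have [g gV fg] := V1_approximation itheta (@cts_fun _ _ f) e0.
exists (mkcts (V1_continuous gV)); split => //.
rewrite -AO; apply: EA; apply/xsectionP; apply: PE => z.
by apply: eP; exact: fg.
Qed.

End UniformDensity.

Theorem corollary4p3 (R : realType) (theta : R) (htheta : irrational theta) :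
  (forall (d : int) (f1 f2 : circle R -> R),
     d != 0 -> continuous f1 -> continuous f2 ->
     V1 theta (f1 \- f2) ->
     conjugate (furstenberg theta d f1) (furstenberg theta d f2)) /\
  dense_in_real_continuous (V1 theta).
Proof.
split; last exact: V1_dense.
by move=> d f1 f2 _ _ _; exact: V1_conjugate.
Qed.
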